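(* Let $k$ be a field, $R=k[x,y]$, and let $(C_n,\alpha)$ be an edge labeled cycle with edge labels $l_1,\ldots,l_n\in R$. Then the spline module $R_{(C_n,\alpha)}$ is a free $R$-module.
   Context: An edge labeled graph $(G,\alpha)$ over a commutative ring $R$ is a finite graph $G=(V,E)$ together with a function $\alpha$ assigning to each edge an ideal of $R$; here each edge $e$ is labeled by an element $l_e\in R$, standing for the principal ideal $\alpha(e)=\langle l_e\rangle$. A generalized spline on $(G,\alpha)$ is a vertex labeling $(f_v)_{v\in V}\in R^{|V|}$ such that $f_u-f_v\in\alpha(uv)$ for every edge $uv\in E$. The set of all generalized splines is the $R$-submodule $R_{(G,\alpha)}\subseteq R^{|V|}$. An edge labeled cycle $(C_n,\alpha)$ is an edge labeled graph whose underlying graph is a cycle with $n$ edges, labeled $l_1,\ldots,l_n$. *)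

(* Defs.v *)
From HB Require Import structures.
From mathcomp Require Import all_boot all_algebra.
From mathcomp Require Import boolp.

Set Implicit Arguments.
Unset Strict Implicit.
Unset Printing Implicit Defensive.

Import GRing.Theory.
Local Open Scope ring_scope.

(* Finite simple graphs: an edge is an unordered pair of distinct vertices. *)
Record sgraph := SGraph {
  vertex :> finType;
  edges : {set {set vertex}};
  card_edges : forall e : {set vertex}, e \in edges -> #|e| = 2%N }.

Definition edge (G : sgraph) := {e : {set G} | e \in edges G}.

(* [ordS i] is the cyclic successor of [i] in ['I_n].  The bound on [n] is the
   usual one: for [n <= 2] a simple graph has no cycle with [n] edges. *)
Definition is_cycle (n : nat) (G : sgraph) : Prop :=
  (2 < n)%N /\
  exists2 v : 'I_n -> G, bijective v
    & edges G = [set [set v i; v (ordS i)] | i : 'I_n].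

(* Ideals are Prop-valued and may be the whole ring, unlike the decidable
   proper ideals [idealr R] of ring_quotient. *)
Record ideal (R : comNzRingType) := Ideal {
  in_ideal :> R -> Prop;
  ideal0 : in_ideal 0;
  idealD : forall a b, in_ideal a -> in_ideal b -> in_ideal (a + b);
  idealM : forall r a, in_ideal a -> in_ideal (r * a) }.

Section PrincipalIdeal.
Variables (R : comNzRingType) (l : R).

Let multiple (a : R) := exists r, a = r * l.

Fact multiple0 : multiple 0.
Proof. by exists 0; rewrite mul0r. Qed.

Fact multipleD a b : multiple a -> multiple b -> multiple (a + b).
Proof. by move=> [r ->] [s ->]; exists (r + s); rewrite mulrDl. Qed.

Fact multipleM r a : multiple a -> multiple (r * a).
Proof. by move=> [s ->]; exists (r * s); rewrite mulrA. Qed.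

Definition principal : ideal R := Ideal multiple0 multipleD multipleM.
End PrincipalIdeal.

Section Splines.
Variables (R : comNzRingType) (G : sgraph) (alpha : edge G -> ideal R).

Definition is_spline (f : {ffun G -> R^o}) : Prop :=
  forall (e : edge G) (u v : G), val e = [set u; v] -> alpha e (f u - f v).

Definition spline : {pred {ffun G -> R^o}} := fun f => `[< is_spline f >].

Fact spline_submod_closed : submod_closed spline.
Proof.
split=> [|a f g /asboolP sf /asboolP sg]; apply/asboolP => e u v euv.
  by rewrite !ffunE subrr; apply: ideal0.
rewrite !ffunE opprD addrACA -scalerBr.
by apply: idealD; [apply: idealM; apply: sf | apply: sg].
Qed.

HB.instance Definition _ :=
  GRing.isSubmodClosed.Build R {ffun G -> R^o} spline
    spline_submod_closed.

(* The submodule of splines, as a module in its own right. *)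
Record spline_module := Spline {
  spline_val :> {ffun G -> R^o};
  _ : spline_val \in spline }.

HB.instance Definition _ := [isSub for spline_val].
HB.instance Definition _ := [Choice of spline_module by <:].
HB.instance Definition _ := [SubChoice_isSubLmodule of spline_module by <:].
End Splines.

(* [b] spans [M] and is linearly independent; the index type may be infinite,
   so that linear combinations range over finite duplicate-free lists. *)
Definition is_basis (R : nzRingType) (M : lmodType R) (I : eqType)
    (b : I -> M) : Prop :=
  (forall m : M, exists (s : seq I) (c : I -> R),
     uniq s /\ m = \sum_(i <- s) c i *: b i) /\
  (forall (s : seq I) (c : I -> R), uniq s ->
     \sum_(i <- s) c i *: b i = 0 -> forall i, i \in s -> c i = 0).

Definition free_module (R : nzRingType) (M : lmodType R) : Prop :=
  exists (I : eqType) (b : I -> M), is_basis b.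

(* Main.v *)
Require Import Defs.
From mathcomp Require Import all_boot all_algebra.
From HB Require Import structures.
From mathcomp Require Import ring zify boolp.

Set Implicit Arguments.
Unset Strict Implicit.
Unset Printing Implicit Defensive.

Import GRing.Theory.
Local Open Scope ring_scope.

(** The polynomial ring k[x, y] is read as A[y] with A = k[x], a principal
    ideal domain.  The proof adapts Seshadri's argument for projective modules over
    A[y] to the submodules M of A[y]^N such that M / pM is torsion-free over
    (A / p)[y] for each irreducible p of A: if v is in M, g v lies in pM and p
    does not divide g, then v lies in pM.

    Such an M is free ([free_rows]).  Let r be the largest size of a nonzero
    minor of a matrix with rows in M, fix the columns of such a minor, and among
    the families e of r elements of M for which this minor D is nonzero take
    one that minimizes first the degree of D in y, then the degree in x of its
    leading coefficient.  By maximality of r, Cramer's rule gives D v in the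
    span F of e for every v in M.  Replacing a row of e by an element of M turns
    D into a Cramer coordinate of that element, so minimality of the degree in
    y makes every Cramer coordinate divisible by D up to a constant of A: each v
    in M has a multiple s v in F with s in A nonzero
    ([constant_multiple_in_span]).  The denominator s disappears because
    F meets pM in pF for each irreducible p.  Otherwise some combination of e
    with a coefficient not divisible by p lies in pM; Euclidean division modulo p
    in (A / p)[y], performed by elementary operations on e, reduces this
    combination to a multiple of a single e_i, torsion-freeness then lets e_i
    be divided by p inside M, and D gets replaced by D / p
    ([divide_minor]), against minimality.

    Splines have the required property ([row_spline_torsion_free_mod]).  If
    v = p u with u a labeling, and v and g u are splines, then the label l of an
    edge divides both p d and g d, where d is the difference of u along that
    edge; since p is prime in A[y] and does not divide g, l divides d, so u is
    a spline. *)

Lemma exists_minimal (T : Type) (P : T -> Prop) (m : T -> nat) :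
  (exists x, P x) -> exists2 x, P x & forall y, P y -> (m x <= m y)%N.
Proof.
move=> [x Px].
have exm : exists n, `[< exists2 y, P y & m y = n >].
  by exists (m x); apply/asboolP; exists x.
case: (ex_minnP exm) => n /asboolP[y Py <-] min_y; exists y => // z Pz.
by apply: min_y; apply/asboolP; exists z.
Qed.

(** * Divisibility by irreducible constants *)

Lemma size_sub_lead (S : nzRingType) (g q : {poly S}) :
  g != 0 -> (size q <= size g)%N ->
  q`_(size g).-1 = lead_coef g -> (size (g - q)%R < size g)%N.
Proof.
move=> g0 qg lq.
have sg : (0 < size g)%N by rewrite size_poly_gt0.
rewrite -(ltn_predK sg) ltnS; apply/leq_sizeP => j.
rewrite leq_eqVlt => /orP[/eqP <-|lj]; first by rewrite coefB lq subrr.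
have jg : (size g <= j)%N by rewrite -(ltn_predK sg).
by rewrite coefB !nth_default ?subrr // (leq_trans qg).
Qed.

Lemma size_scaleXn_leq (S : nzRingType) (a : S) d :
  (size (a *: 'X^d) <= d.+1)%N.
Proof. by rewrite (leq_trans (size_scale_leq _ _)) ?size_polyXn. Qed.

Section ConstantPrimes.
Variable k : fieldType.
Local Notation R := {poly {poly k}}.
Implicit Types (p a b : {poly k}) (f g h q t : R).

(** Divisibility by a constant is spelled out because [%|] on polynomials over
    k[x] is pseudo-divisibility, that is divisibility over k(x), for which all
    nonzero constants are units. *)
Definition dvdC p g := exists h, g = p%:P * h.

Lemma dvdC_add_mull p g t : dvdC p (g + p%:P * t) -> dvdC p g.
Proof.
by move=> [h gh]; exists (h - t); rewrite mulrBr -gh addrK.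
Qed.

(** Together with [euclid_step], this is Euclidean division in (A / p)[y] without
    the quotient ring: a polynomial that is nonzero modulo p is represented by
    one whose leading coefficient is prime to p. *)
Lemma cancel_lead p g : g != 0 -> p %| lead_coef g ->
  exists t, (size (g - p%:P * t)%R < size g)%N.
Proof.
move=> g0 /dvdpP[a la]; exists (a *: 'X^((size g).-1)).
have sg : (0 < size g)%N by rewrite size_poly_gt0.
rewrite mul_polyC scalerA; apply: size_sub_lead => //.
  by rewrite (leq_trans (size_scaleXn_leq _ _)) ?prednK.
by rewrite coefZ coefXn eqxx mulr1 la mulrC.
Qed.

(** If u p + v lc(h) = 1, then lc(g) = lc(g) u p + lc(g) v lc(h), so the leading
    term of g is the sum of a multiple of the leading term of h and of a multiple
    of p. *)
Lemma euclid_step p g h : irreducible_poly p -> h != 0 ->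
  ~~ (p %| lead_coef h) -> (size h <= size g)%N ->
  exists q t, (size (g - (q * h + p%:P * t))%R < size g)%N.
Proof.
move=> irrp h0; rewrite -(irreducible_poly_coprime _ irrp).
move=> /Bezout_eq1_coprimepP[[u v] /= uv] hg.
have sh : (0 < size h)%N by rewrite size_poly_gt0.
have sg : (0 < size g)%N by apply: leq_trans hg.
have g0 : g != 0 by rewrite -size_poly_gt0.
exists ((lead_coef g * v) *: 'X^(size g - size h)).
exists ((lead_coef g * u) *: 'X^((size g).-1)).
apply: size_sub_lead => //.
  rewrite (leq_trans (size_polyD _ _)) // geq_max; apply/andP; split.
    rewrite (leq_trans (size_polyMleq _ _)) //.
    apply: (@leq_trans ((size g - size h).+1 + size h).-1).
      by rewrite -!subn1 leq_sub2r // leq_add2r size_scaleXn_leq.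
    by rewrite addSn subnK.
  rewrite mul_polyC scalerA.
  by rewrite (leq_trans (size_scaleXn_leq _ _)) ?prednK.
rewrite coefD mul_polyC scalerA coefZ coefXn eqxx mulr1.
rewrite -scalerAl coefZ mulrC [_ * h]mulrC coefMXn.
have arith x y : (0 < y)%N -> (y <= x)%N ->
    (x.-1 < x - y)%N = false /\ (x.-1 - (x - y) = y.-1)%N by lia.
have [-> ->] := arith _ _ sh hg.
rewrite -lead_coefE -[RHS]mulr1 -uv; ring.
Qed.

(** Irreducibles of A stay prime in A[y]: strip leading terms divisible by p, until
    p divides the product of two leading coefficients that are prime to it. *)
Lemma dvdC_prime p g h :
  irreducible_poly p -> dvdC p (g * h) -> dvdC p g \/ dvdC p h.
Proof.
move=> irrp; have [n] := ubnP (size g + size h)%N.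
elim: n => // n IHn in g h *; rewrite ltnS => le_n dvgh.
have [->|g0] := eqVneq g 0; first by left; exists 0; rewrite mulr0.
have [->|h0] := eqVneq h 0; first by right; exists 0; rewrite mulr0.
have [pg|pg] := boolP (p %| lead_coef g).
  have [t lt_t] := cancel_lead g0 pg.
  have [||dvg|] := IHn (g - p%:P * t) h; [by lia| |left|by right].
    apply: (@dvdC_add_mull _ _ (t * h)).
    by rewrite mulrA -mulrDl subrK.
  by apply: (@dvdC_add_mull _ _ (- t)); rewrite mulrN.
have [ph|ph] := boolP (p %| lead_coef h).
  have [t lt_t] := cancel_lead h0 ph.
  have [|||dvh] := IHn g (h - p%:P * t); [by lia| |by left|right].
    apply: (@dvdC_add_mull _ _ (g * t)).
    by rewrite mulrCA -mulrDr subrK.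
  by apply: (@dvdC_add_mull _ _ (- t)); rewrite mulrN.
have [q ghq] := dvgh.
have : p %| lead_coef (g * h) by rewrite ghq lead_coefM lead_coefC dvdp_mulr.
rewrite lead_coefM Gauss_dvdpr ?irreducible_poly_coprime //.
by rewrite (negbTE ph).
Qed.

End ConstantPrimes.

(** * Maximal minors and row replacement *)

Lemma scale_rowI (S : idomainType) n (a : S) :
  a != 0 -> injective (fun v : 'rV[S]_n => a *: v).
Proof.
move=> a0 v w /rowP vw; apply/rowP => j; apply: (mulfI a0).
by have := vw j; rewrite !mxE.
Qed.

Section ReplaceRow.
Variables (S : comNzRingType) (r N : nat).
Implicit Types (i : 'I_r).

Definition setrow n i (v : 'rV[S]_n) (e : 'M[S]_(r, n)) :=
  \matrix_(a, j) if a == i then v 0 j else e a j.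

Lemma row_setrow n i a (v : 'rV[S]_n) e :
  row a (setrow i v e) = if a == i then v else row a e.
Proof. by apply/rowP => j; rewrite !mxE; case: ifP => // _; rewrite mxE. Qed.

(** Laplace expansion along the new row, whose cofactors are those of B. *)
Lemma det_setrow i (v : 'rV[S]_r) (B : 'M[S]_r) :
  \det (setrow i v B) = (v *m \adj B) 0 i.
Proof.
rewrite (expand_det_row _ i) mxE; apply: eq_bigr => j _.
rewrite mxE eqxx [\adj B _ _]mxE; congr (_ * (_ * \det _)).
apply/matrixP => a b; rewrite !mxE.
by rewrite eq_sym (negbTE (neq_lift _ _)).
Qed.

Lemma mul_setrow i (v : 'rV[S]_N) e (c : 'rV[S]_r) :
  c *m setrow i v e = c *m e + c 0 i *: (v - row i e).
Proof.
have -> : setrow i v e = e + delta_mx i 0 *m (v - row i e).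
  apply/matrixP => a j; rewrite !mxE big_ord1 !mxE eqxx andbT.
  case: eqP => [->|_]; first by rewrite mul1r addrC subrK.
  by rewrite mul0r addr0.
rewrite mulmxDr mulmxA -colE [col i c]mx11_scalar mul_scalar_mx.
by rewrite mxE.
Qed.

Variable f : 'I_r -> 'I_N.

Definition minor (e : 'M[S]_(r, N)) := \det (colsub f e).

(** The coefficients that Cramer's rule gives for v on the rows of e, multiplied
    by the minor, using only the columns selected by f. *)
Definition cramer (e : 'M[S]_(r, N)) (v : 'rV[S]_N) : 'rV[S]_r :=
  colsub f v *m \adj (colsub f e).

Lemma minor_setrow i v e : minor (setrow i v e) = cramer e v 0 i.
Proof.
rewrite -det_setrow; congr (\det _).
by apply/matrixP => a b; rewrite !mxE.
Qed.

Lemma cramer_mul e c : cramer e (c *m e) = minor e *: c.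
Proof.
by rewrite /cramer -mulmx_colsub -mulmxA mul_mx_adj mul_mx_scalar.
Qed.

Lemma cramerZ e a v : cramer e (a *: v) = a *: cramer e v.
Proof.
rewrite /cramer scalemxAl; congr (_ *m _).
by apply/matrixP => i j; rewrite !mxE.
Qed.

Lemma cramerB e v w : cramer e (v - w) = cramer e v - cramer e w.
Proof.
rewrite /cramer -mulmxBl; congr (_ *m _).
by apply/matrixP => i j; rewrite !mxE.
Qed.

Lemma minor_size_gt e : (N < r)%N -> minor e = 0.
Proof.
move=> lt_Nr; have /injectivePn[i [j ij fij]] : ~~ injectiveb f.
  apply/injectiveP => /leq_card; rewrite !card_ord.
  by rewrite leqNgt lt_Nr.
rewrite /minor -det_tr (determinant_alternate ij) // => a.
by rewrite !mxE fij.
Qed.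

End ReplaceRow.

(** * Free submodules of a free module over k[x, y] *)

Section Submodule.
Variables (k : fieldType) (N : nat).
Local Notation R := {poly {poly k}}.
Variable M : submodClosed 'rV[R]_N.

Lemma memB v w : v \in M -> w \in M -> v - w \in M.
Proof. by move=> vM wM; rewrite -scaleN1r rpredD ?rpredZ. Qed.

Definition rows_in r (e : 'M[R]_(r, N)) := forall i, row i e \in M.

Lemma mulmx_rows_in r (e : 'M[R]_(r, N)) c : rows_in e -> c *m e \in M.
Proof.
by move=> eM; rewrite mulmx_sum_row rpred_sum // => i _; rewrite rpredZ.
Qed.

Lemma rows_in_setrow r (e : 'M[R]_(r, N)) i v :
  rows_in e -> v \in M -> rows_in (setrow i v e).
Proof. by move=> eM vM a; rewrite row_setrow; case: ifP. Qed.

(** The difference of the two sides vanishes in the columns of f, so bordering the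
    minor with it and with one more column j gives the minor of size r + 1 equal
    to the product of [minor f e] with the entry j of the difference. *)
Lemma cramer_maximal r (f : 'I_r -> 'I_N) e v :
  (forall (f' : 'I_(r + 1) -> 'I_N) e', rows_in e' -> minor f' e' = 0) ->
  rows_in e -> minor f e != 0 -> v \in M ->
  minor f e *: v = cramer f e v *m e.
Proof.
move=> maxr eM D0 vM; apply/eqP; rewrite -subr_eq0; apply/eqP.
set w := _ - _; apply/rowP => j; rewrite [RHS]mxE.
have wM : w \in M by rewrite memB ?rpredZ ?mulmx_rows_in.
have wf : colsub f w = 0.
  rewrite /w linearB /= -mulmx_colsub /cramer -mulmxA mul_adj_mx.
  rewrite mul_mx_scalar; apply/eqP; rewrite subr_eq0; apply/eqP.
  by apply/matrixP => a b; rewrite !mxE.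
pose f' (a : 'I_(r + 1)) := if split a is inl b then f b else j.
have := maxr f' (col_mx e w).
have -> : minor f' (col_mx e w) = minor f e * w 0 j.
  rewrite /minor.
  have -> : colsub f' (col_mx e w) =
    block_mx (colsub f e) (col j e) 0 (w 0 j)%:M.
    rewrite -wf; apply/matrixP => a b; rewrite !mxE /f'.
    by case: (split a) => a'; rewrite ?mxE; case: (split b) => b';
      rewrite !mxE // !ord1 eqxx mulr1n.
  by rewrite det_ublock det_scalar1.
move=> /(_ _)/eqP; rewrite mulf_eq0 (negbTE D0) /= => h; apply/eqP/h.
move=> a; rewrite -[a]splitK; case: (split a) => b /=.
  by rewrite rowKu.
by rewrite rowKd row_id.
Qed.

(* M / pM is torsion-free over (k[x] / p)[y]. *)
Hypothesis torsion_free_mod : forall p g v w,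
  irreducible_poly p -> ~ dvdC p g -> v \in M -> w \in M ->
  g *: v = p%:P *: w -> exists2 u, u \in M & v = p%:P *: u.

(** Induction on the total size of the coefficients of c.  Leading terms divisible
    by p are removed from c at the expense of w.  When two coefficients
    are left with leading coefficients prime to p, a Euclidean step shortens the
    longer one, and the row operation that compensates for it preserves the minor.
    When only one coefficient is left, its row can be divided by p in M. *)
Lemma divide_minor r (f : 'I_r -> 'I_N) p e c w :
  irreducible_poly p -> rows_in e -> w \in M ->
  c *m e = p%:P *: w -> (exists i, ~ dvdC p (c 0 i)) ->
  exists2 e', rows_in e' & minor f e = p%:P * minor f e'.
Proof.
move=> irrp; have [n] := ubnP (\sum_i size (c 0%R i))%N.
elim: n => // n IHn in e c w *; rewrite ltnS => le_n eM wM cew [i0 ndv].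
have decr (c' : 'rV[R]_r) i : (size (c' 0%R i) < size (c 0%R i))%N ->
    (forall j, j != i -> c' 0 j = c 0 j) -> (\sum_j size (c' 0 j)%R < n)%N.
  move=> lt_i eq_c; apply: leq_trans le_n.
  rewrite (bigD1 i) // [X in (_ < X)%N](bigD1 i) //= -addSn leq_add //.
  by apply: leq_sum => j /eq_c ->.
pose sub i a : 'rV_r := c - a *: delta_mx 0 i.
have subi i a : sub i a 0 i = c 0 i - a by rewrite !mxE !eqxx mulr1.
have subj i a j : j != i -> sub i a 0 j = c 0 j.
  by move=> ji; rewrite !mxE (negbTE ji) andbF mulr0 subr0.
have mulsub i a (e1 : 'M_(r, N)) : sub i a *m e1 = c *m e1 - a *: row i e1.
  by rewrite mulmxBl -scalemxAl -rowE.
have [i /andP[ci pi]|nlead] :=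
    pickP (fun i => (c 0 i != 0) && (p %| lead_coef (c 0 i))).
  have [t lt_t] := cancel_lead ci pi.
  apply: (IHn e (sub i (p%:P * t)) (w - t *: row i e)) => //.
  - by apply: (decr _ i) => [|j]; [rewrite subi|apply: subj].
  - by rewrite memB ?rpredZ.
  - by rewrite mulsub cew scalerBr scalerA.
  - exists i0; have [ii|ne] := eqVneq i0 i; last by rewrite subj.
    rewrite ii subi => dv; apply: ndv; rewrite ii.
    by apply: (@dvdC_add_mull _ _ _ (- t)); rewrite mulrN.
have nlead_p i : c 0 i != 0 -> ~~ (p %| lead_coef (c 0 i)).
  by move=> ci; have := nlead i; rewrite ci => /= ->.
have ci0 : c 0 i0 != 0.
  by apply/eqP => c0; apply: ndv; rewrite c0; exists 0; rewrite mulr0.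
have cramer_row a b : cramer f e (row a e) 0 b = minor f e * (a == b)%:R.
  by rewrite rowE cramer_mul !mxE eqxx eq_sym.
have [j /andP[ji cj]|single] := pickP (fun j => (j != i0) && (c 0 j != 0)).
  have [a [b [ba ca cb le_ba]]] : exists a b, [/\ b != a, c 0 a != 0,
      c 0 b != 0 & (size (c 0%R b) <= size (c 0%R a))%N].
    have [le_ij|/ltnW le_ji] := leqP (size (c 0%R i0)) (size (c 0%R j)).
      by exists j, i0; split=> //; rewrite eq_sym.
    by exists i0, j.
  have [q [t lt_qt]] := euclid_step irrp cb (nlead_p _ cb) le_ba.
  (* c_a e_a + c_b e_b = (c_a - q c_b) e_a + c_b (e_b + q e_a) *)
  pose e1 := setrow b (row b e + q *: row a e) e.
  have e1M : rows_in e1 by apply: rows_in_setrow => //; rewrite rpredD ?rpredZ.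
  have [||||e2 e2M] :=
      IHn e1 (sub a (q * c 0 b + p%:P * t)) (w - t *: row a e) _ e1M.
  - by apply: (decr _ a) => [|j']; [rewrite subi|apply: subj].
  - by rewrite memB ?rpredZ.
  - rewrite mul_setrow mulsub subj // [row b e + _]addrC addrK cew.
    rewrite scalerBr !scalerA scalerDl opprD [c 0 b * q]mulrC.
    by rewrite -addrA [- _ - _]addrC subrK.
  - exists b; rewrite subj // => -[h ch].
    have := nlead_p _ cb.
    by rewrite ch lead_coefM lead_coefC dvdp_mulr.
  move=> minor_e1; exists e2 => //; rewrite -minor_e1 minor_setrow.
  have -> : row b e + q *: row a e = (delta_mx 0 b + q *: delta_mx 0 a) *m e.
    by rewrite mulmxDl -scalemxAl -!rowE.
  rewrite cramer_mul !mxE !eqxx (negbTE ba).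
  by rewrite mulr0 addr0 mulr1.
have crow : c *m e = c 0 i0 *: row i0 e.
  rewrite mulmx_sum_row (bigD1 i0) //= big1 ?addr0 // => j ji.
  by have := single j; rewrite ji => /negbFE/eqP ->; rewrite scale0r.
have [|u uM eu] := torsion_free_mod irrp ndv (eM i0) wM.
  by rewrite -crow.
exists (setrow i0 u e); first exact: rows_in_setrow.
rewrite minor_setrow; have := cramer_row i0 i0.
by rewrite eu cramerZ mxE eqxx mulr1.
Qed.

(** The remainder of a Cramer coordinate of v modulo the minor D is itself a minor:
    the one obtained when row i of e is replaced by a constant multiple of v minus
    a multiple of that row.  As its degree in y is smaller than that of D, it is
    zero. *)
Lemma constant_multiple_in_span r (f : 'I_r -> 'I_N) e v :
  (forall (f' : 'I_(r + 1) -> 'I_N) e', rows_in e' -> minor f' e' = 0) ->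
  (forall e', rows_in e' -> minor f e' != 0 ->
     (size (minor f e : R) <= size (minor f e' : R))%N) ->
  rows_in e -> minor f e != 0 -> v \in M ->
  exists2 s : {poly k}, s != 0 & exists c, s%:P *: v = c *m e.
Proof.
move=> maxr min_e eM D0 vM; set D := minor f e in min_e D0 *.
have /fin_all_exists[sq sqP] i : exists sq : {poly k} * R,
    sq.1 != 0 /\ sq.1%:P * cramer f e v 0 i = sq.2 * D.
  set ci := cramer f e v 0 i.
  exists (lead_coef D ^+ scalp ci D, ci %/ D); split=> /=.
    by rewrite expf_neq0 ?lead_coef_eq0.
  have := Pdiv.Idomain.divp_eq ci D; rewrite -mul_polyC => divD.
  have e1M : rows_in
      (setrow i ((lead_coef D ^+ scalp ci D)%:P *: v - (ci %/ D) *: row i e) e).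
    by apply: rows_in_setrow => //; rewrite memB ?rpredZ.
  have := min_e _ e1M; rewrite minor_setrow cramerB !cramerZ rowE cramer_mul.
  have -> : ((lead_coef D ^+ scalp ci D)%:P *: cramer f e v
             - (ci %/ D) *: (minor f e *: 'e_i)) 0 i = ci %% D.
    rewrite [LHS]mxE [(_ *: cramer _ _ _) _ _]mxE -/ci divD !mxE !eqxx mulr1.
    by rewrite addrAC subrr add0r.
  rewrite leqNgt Pdiv.Idomain.ltn_modp D0 divD.
  by have [->|_ /(_ isT)] := eqVneq (ci %% D) 0; first by rewrite addr0.
exists (\prod_i (sq i).1).
  by apply/prodf_neq0 => i _; case: (sqP i).
exists (\row_i ((\prod_(j | j != i) (sq j).1)%:P * (sq i).2)).
apply: (scale_rowI D0); rewrite /= scalerA mulrC -scalerA.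
rewrite (cramer_maximal maxr) //.
rewrite scalemxAl [RHS]scalemxAl; congr (_ *m _); apply/rowP => i.
rewrite [LHS]mxE [RHS]mxE [(\row__ _) _ _]mxE (bigD1 i) //= polyCM mulrAC.
by case: (sqP i) => _ ->; ring.
Qed.

(** A nonconstant s is cancelled one irreducible factor at a time. *)
Lemma span_saturated r (e : 'M[R]_(r, N)) :
  (forall p c w, irreducible_poly p -> w \in M -> c *m e = p%:P *: w ->
     exists c', w = c' *m e) ->
  forall (s : {poly k}) v c, s != 0 -> v \in M -> s%:P *: v = c *m e ->
  exists c', v = c' *m e.
Proof.
move=> sat_p s; have [n] := ubnP (size s).
elim: n => // n IHn in s *; rewrite ltnS => le_n v c s0 vM svc.
have [irr|red] := pselect (irreducible_poly s);
  first exact: sat_p irr vM (esym svc).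
have [/eqP/size_poly1P[a a0 sa]|s1] := eqVneq (size s) 1%N.
  exists ((a^-1)%:P%:P *: c); rewrite -scalemxAl -svc scalerA sa.
  by rewrite -!rmorphM mulVf // !rmorph1 scale1r.
have [q [q1 qs nqs]] : exists q : {poly k},
    [/\ size q != 1%N, q %| s & ~~ (q %= s)].
  apply: contrapT => nq; apply: red; split=> [|q q1 qs].
    by rewrite ltn_neqAle eq_sym s1 size_poly_gt0.
  by apply: contrapT => /negP nqs; apply: nq; exists q.
have /dvdpP[b sbq] := qs.
have [b0 q0] : b != 0 /\ q != 0.
  by move: s0; rewrite sbq mulf_eq0 negb_or => /andP.
have lt_q : (size q < size s)%N.
  by rewrite ltn_neqAle dvdp_leq // andbT dvdp_size_eqp.
have lt_b : (size b < size s)%N.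
  have q_gt1 : (1 < size q)%N by rewrite ltn_neqAle eq_sym q1 size_poly_gt0.
  by rewrite sbq size_mul // -(prednK (ltnW q_gt1)) addnS /= -addn1
    leq_add2l -ltnS prednK // ltnW.
have [||c' qv] := IHn b (leq_trans lt_b le_n) (q%:P *: v) c b0.
- by rewrite rpredZ.
- by rewrite scalerA -rmorphM -sbq.
exact: IHn (leq_trans lt_q le_n) v c' q0 vM qv.
Qed.

Theorem free_rows : exists r (e : 'M[R]_(r, N)),
  [/\ rows_in e, forall v, v \in M -> exists c, v = c *m e
    & forall c : 'rV_r, c *m e = 0 -> c = 0].
Proof.
pose nonzero r (fe : ('I_r -> 'I_N) * 'M[R]_(r, N)) :=
  rows_in fe.2 /\ minor fe.1 fe.2 != 0.
have exr : exists r, `[< exists fe, @nonzero r fe >].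
  exists 0; apply/asboolP.
  exists (fun i : 'I_0 => False_rect _ (notF (valP i)), 0).
  by split=> [[]|] //; rewrite /minor det_mx00 oner_neq0.
have leN r : `[< exists fe, @nonzero r fe >] -> (r <= N)%N.
  move=> /asboolP[[f e] [_ /= D0]]; rewrite leqNgt; apply: contra_neqN D0.
  exact: minor_size_gt.
case: (ex_maxnP exr leN) => r /asboolP[[f e0] [/= e0M D0]] max_r.
have maxr (f' : 'I_(r + 1) -> 'I_N) e' : rows_in e' -> minor f' e' = 0.
  move=> e'M; apply/eqP; apply: contraT => D'0.
  have : (r + 1 <= r)%N by apply/max_r/asboolP; exists (f', e').
  by rewrite addn1 ltnn.
pose P (e : 'M[R]_(r, N)) := rows_in e /\ minor f e != 0.
(* The minor is minimized lexicographically: first its degree in y, then the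
   degree in x of its leading coefficient. *)
have [e1 Pe1 min_e1] :=
  exists_minimal (fun e => size (minor f e : R)) (ex_intro P e0 (conj e0M D0)).
pose P1 e := P e /\ (size (minor f e : R) <= size (minor f e1 : R))%N.
have [e [[eM De0] le_ee1] min_e] :=
  exists_minimal (fun e => size (lead_coef (minor f e : R)))
    (ex_intro P1 e1 (conj Pe1 (leqnn _))).
exists r, e; split=> // [v vM|c ce]; last first.
  apply: (scale_rowI De0); rewrite /= -cramer_mul ce /cramer scaler0.
  have -> : colsub f (0 : 'rV[R]_N) = 0 by apply/matrixP => i j; rewrite !mxE.
  by rewrite mul0mx.
have [|s s0 [c svc]] := constant_multiple_in_span maxr _ eM De0 vM.
  by move=> e' e'M D'0; apply: leq_trans le_ee1 _; apply: min_e1.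
apply: span_saturated s0 vM svc => p c' w irrp wM c'e.
have p0 := irredp_neq0 irrp.
have /fin_all_exists[h ch] i : dvdC p (c' 0 i).
  apply: contrapT => ndv.
  have [|e' e'M De] := divide_minor f irrp eM wM c'e; first by exists i.
  have D'0 : minor f e' != 0.
    by apply: contraNneq De0 => D'0; rewrite De D'0 mulr0.
  have := min_e e'; rewrite De; case/(_ _)/idPn.
    split; first by split.
    apply: leq_trans le_ee1; rewrite De mul_polyC size_scale //.
  rewrite -ltnNge lead_coefM lead_coefC size_mul ?lead_coef_eq0 //.
  have [p_gt1 _] := irrp.
  rewrite -(prednK (ltnW p_gt1)) addSn /= -[X in (X < _)%N]add0n ltn_add2r.
  by rewrite -ltnS prednK // ltnW.
exists (\row_i h i); apply: (@scale_rowI _ _ p%:P); first by rewrite polyC_eq0.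
rewrite /= -c'e scalemxAl; congr (_ *m _); apply/rowP => i; rewrite !mxE.
exact: ch.
Qed.
End Submodule.

(** * Splines *)

Section RowSplines.
Variables (S : comNzRingType) (G : sgraph) (alpha : edge G -> ideal S).

(** Labelings are read as row vectors, so that families of splines become matrices
    and have minors. *)
Definition labeling (v : 'rV[S]_#|G|) : {ffun G -> S^o} :=
  [ffun u => v 0 (enum_rank u)].

Definition row_spline : {pred 'rV[S]_#|G|} :=
  fun v => labeling v \in spline alpha.

Lemma labelingP a v w : labeling (a *: v + w) = a *: labeling v + labeling w.
Proof. by apply/ffunP => u; rewrite !ffunE !mxE. Qed.

Fact row_spline_closed : submod_closed row_spline.
Proof.
split=> [|a v w vS wS]; rewrite unfold_in.
  have -> : labeling 0 = 0 by apply/ffunP => u; rewrite !ffunE mxE.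
  exact: rpred0.
by rewrite labelingP rpredD ?rpredZ.
Qed.

HB.instance Definition _ :=
  GRing.isSubmodClosed.Build S 'rV[S]_#|G| row_spline row_spline_closed.

End RowSplines.

(** Since p is prime, p d = r l puts p into r or into l.  In the first case l divides
    d at once; in the second, with l = p l' and d = r l', the equation for g d reads
    g r = s p, hence p divides r after all. *)
Lemma dvd_of_constant_prime_and_coprime (k : fieldType) p
    (g d l r s : {poly {poly k}}) :
  irreducible_poly p -> ~ dvdC p g -> p%:P * d = r * l -> g * d = s * l ->
  exists t, d = t * l.
Proof.
move=> irrp ndg pd gd.
have p0 : p%:P != 0 :> {poly {poly k}} by rewrite polyC_eq0 irredp_neq0.
have [[r' rE]|[l' lE]] : dvdC p r \/ dvdC p l.
  by apply: dvdC_prime => //; exists d.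
  by exists r'; apply: (mulfI p0); rewrite pd rE mulrA.
have dE : d = r * l' by apply: (mulfI p0); rewrite pd lE mulrCA.
have [l0|l0] := eqVneq l' 0.
  by exists 0; rewrite dE l0 mulr0 mul0r.
have [|//|[r' rE]] := dvdC_prime (g := g) (h := r) irrp.
  exists s; apply: (mulIf l0).
  by rewrite -mulrA -dE gd lE mulrCA mulrA.
by exists r'; rewrite dE rE lE mulrCA mulrA.
Qed.

Section SplineModule.
Variables (k : fieldType) (G : sgraph) (l : edge G -> {poly {poly k}}).
Local Notation R := {poly {poly k}}.
Local Notation alpha := (fun e => principal (l e)).

Lemma row_spline_torsion_free_mod p (g : R) (v w : 'rV[R]_#|G|) :
  irreducible_poly p -> ~ dvdC p g -> v \in row_spline alpha ->
  w \in row_spline alpha -> g *: v = p%:P *: w ->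
  exists2 u, u \in row_spline alpha & v = p%:P *: u.
Proof.
move=> irrp ndg /asboolP vS /asboolP wS gv.
have p0 : p%:P != 0 :> R by rewrite polyC_eq0 irredp_neq0.
have gvj j : g * v 0 j = p%:P * w 0 j by have /rowP/(_ j) := gv; rewrite !mxE.
have /fin_all_exists[h hP] j : dvdC p (v 0 j).
  by have [|//|//] := @dvdC_prime _ p g (v 0 j) irrp; exists (w 0 j).
exists (\row_j h j); last by apply/rowP => j; rewrite !mxE.
apply/asboolP => e a b eab; rewrite !ffunE !mxE.
have [r] := vS e a b eab; rewrite !ffunE !hP -mulrBr => pd.
have [s] := wS e a b eab; rewrite !ffunE => wd.
apply: (dvd_of_constant_prime_and_coprime irrp ndg pd (s := s)).
by apply: (mulfI p0); rewrite -wd mulrCA !mulrBr -!hP !gvj.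
Qed.

Theorem spline_module_free : free_module (spline_module alpha).
Proof.
have [r [e [eS span indep]]] := free_rows row_spline_torsion_free_mod.
pose b i : spline_module alpha := Spline (eS i).
have val_sum (s : seq 'I_r) (c : 'I_r -> R) : uniq s ->
    val (\sum_(i <- s) c i *: b i) =
    labeling ((\row_i if i \in s then c i else 0) *m e).
  move=> us; apply/ffunP => u.
  rewrite raddf_sum sum_ffunE ffunE mxE big_uniq //= big_mkcond /=.
  apply: eq_bigr => i _; rewrite !mxE; case: ifP => _; last by rewrite mul0r.
  by rewrite !ffunE mxE.
have labeling_inj : injective (@labeling R G).
  move=> v w vw; apply/rowP => j.
  by have /ffunP/(_ (enum_val j)) := vw; rewrite !ffunE enum_valK.
exists 'I_r, b; split=> [m|s c us sum0 i si].
  have mS : (\row_j val m (enum_val j)) \in row_spline alpha.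
    rewrite unfold_in (_ : labeling _ = val m) ?(valP m) //.
    by apply/ffunP => u; rewrite ffunE mxE enum_rankK.
  have [c mE] := span _ mS.
  exists (enum 'I_r), (c 0); split; first exact: enum_uniq.
  apply: val_inj; rewrite val_sum ?enum_uniq //.
  have -> : (\row_i if i \in enum 'I_r then c 0 i else 0) = c.
    by apply/rowP => i; rewrite mxE mem_enum.
  by rewrite -mE; apply/ffunP => u; rewrite ffunE mxE enum_rankK.
have /rowP/(_ i) : \row_i (if i \in s then c i else 0) = 0.
  apply/indep/labeling_inj; rewrite -val_sum // sum0.
  by apply/ffunP => u; rewrite !ffunE mxE.
by rewrite !mxE si.
Qed.
End SplineModule.

Theorem proposition5p1 (k : fieldType) (n : nat) (G : sgraph)
    (cycG : is_cycle n G) (l : edge G -> {poly {poly k}}) :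
  free_module (spline_module (fun e => principal (l e))).
Proof. exact: spline_module_free. Qed.
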